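(* Let $\mathcal{A}$ be an $\varepsilon$-differentially private algorithm with domain $\mathcal{X}^n$ and range $\mathcal{Y}$. For a distribution $\mathcal{P}$ over $\mathcal{X}$, let $\boldsymbol{S}$ be a random variable drawn from $\mathcal{P}^n$, and let $\boldsymbol{Y}=\mathcal{A}(\boldsymbol{S})$ denote the random variable output by $\mathcal{A}$ on input $\boldsymbol{S}$. Then for any $\beta>0$, $$I_\infty^\beta(\boldsymbol{S};\mathcal{A}(\boldsymbol{S}))\le\log e\cdot\left(\varepsilon^2n/2+\varepsilon\sqrt{n\ln(2/\beta)/2}\right).$$
   Context: All random variables take values in finite domains; $\log$ is the binary logarithm and $\ln$ the natural logarithm. $\mathcal{P}^n$ is the distribution of $n$ i.i.d. samples from $\mathcal{P}$. For random variables $\boldsymbol{U},\boldsymbol{V}$ over the same domain $\mathcal{D}$, $$D_\infty(\boldsymbol{U}\|\boldsymbol{V})=\log\max_{x\in\mathcal{D}}\frac{\Pr[\boldsymbol{U}=x]}{\Pr[\boldsymbol{V}=x]},\qquad D_\infty^\delta(\boldsymbol{U}\|\boldsymbol{V})=\log\max_{\mathcal{O}\subseteq\mathcal{D},\ \Pr[\boldsymbol{U}\in\mathcal{O}]>\delta}\frac{\Pr[\boldsymbol{U}\in\mathcal{O}]-\delta}{\Pr[\boldsymbol{V}\in\mathcal{O}]}.$$ A randomized algorithm $\mathcal{A}$ with domain $\mathcal{X}^n$ is $\varepsilon$-differentially private if for all $S,S'\in\mathcal{X}^n$ that differ in a single element, $D_\infty(\mathcal{A}(S)\|\mathcal{A}(S'))\le\log(e^\varepsilon)$.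 For jointly distributed $\boldsymbol{X},\boldsymbol{Y}$, $\boldsymbol{X}\times\boldsymbol{Y}$ denotes the random variable obtained by drawing them independently from their marginal distributions, and $I_\infty^\beta(\boldsymbol{X};\boldsymbol{Y})=D_\infty^\beta((\boldsymbol{X},\boldsymbol{Y})\|\boldsymbol{X}\times\boldsymbol{Y})$. *)

(* Defs.v *)
From HB Require Import structures.
From mathcomp Require Import all_boot all_order all_algebra.
From mathcomp Require Import reals ereal sequences exp.

Set Implicit Arguments.
Unset Strict Implicit.
Unset Printing Implicit Defensive.

Import Order.TTheory GRing.Theory Num.Theory.

Local Open Scope ring_scope.

(* A random variable over a finite domain is represented by its law: every
   notion below depends on (joint) laws only. *)
Record distr (R : realType) (T : finType) := Distr {
  pmf :> T -> R;
  pmf_ge0 : forall x, 0 <= pmf x;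
  pmf_sum1 : \sum_x pmf x = 1
}.

Definition Pr (R : realType) (T : finType) (mu : distr R T) (E : {set T}) : R :=
  \sum_(x in E) mu x.

Section Constructions.
Variable R : realType.

Section Map.
Variables (T U : finType) (f : T -> U) (mu : distr R T).

Definition dmap_pmf (u : U) : R := Pr mu [set x | f x == u].

Fact dmap_ge0 u : 0 <= dmap_pmf u.
Proof. by apply: sumr_ge0 => x _; apply: pmf_ge0. Qed.

Fact dmap_sum1 : \sum_u dmap_pmf u = 1.
Proof.
rewrite -(pmf_sum1 mu) (partition_big f xpredT) //=; apply: eq_bigr => u _.
by apply: eq_bigl => x; rewrite inE.
Qed.

(* The law of [f X], for [X] of law [mu]. *)
Definition dmap : distr R U := Distr dmap_ge0 dmap_sum1.
End Map.

Section Joint.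
Variables (T U : finType) (mu : distr R T) (K : T -> distr R U).

Definition djoint_pmf (p : T * U) : R := mu p.1 * K p.1 p.2.

Fact djoint_ge0 p : 0 <= djoint_pmf p.
Proof. by apply: mulr_ge0; apply: pmf_ge0. Qed.

Fact djoint_sum1 : \sum_p djoint_pmf p = 1.
Proof.
rewrite -(pair_bigA _ (fun x y => mu x * K x y)) /= -(pmf_sum1 mu).
by apply: eq_bigr => x _; rewrite -mulr_sumr pmf_sum1 mulr1.
Qed.

(* The law of [(X, K X)], for [X] of law [mu] and a randomized map [K]. *)
Definition djoint : distr R (T * U)%type := Distr djoint_ge0 djoint_sum1.
End Joint.

Definition dprod (T U : finType) (mu : distr R T) (nu : distr R U) :
  distr R (T * U)%type := djoint mu (fun=> nu).

Section Iid.
Variables (X : finType) (P : distr R X) (n : nat).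

Definition diid_pmf (s : (X ^ n)%type) : R := \prod_(i < n) P (s i).

Fact diid_ge0 s : 0 <= diid_pmf s.
Proof. by apply: prodr_ge0 => i _; apply: pmf_ge0. Qed.

Fact diid_sum1 : \sum_s diid_pmf s = 1.
Proof.
rewrite -(bigA_distr_bigA (fun (_ : 'I_n) x => P x)) /=.
by rewrite big1 // => i _; apply: pmf_sum1.
Qed.

Definition diid : distr R (X ^ n)%type := Distr diid_ge0 diid_sum1.
End Iid.

End Constructions.

Section Divergences.
Variable R : realType.
Local Open Scope ereal_scope.

(* Binary logarithm on [0, +oo], with log2 0 = -oo and log2 +oo = +oo. *)
Definition log2 (x : \bar R) : \bar R := lne x / (ln 2)%:E.

(* The quotients are taken in the extended reals, where p / 0 = +oo for p > 0
   and 0 / 0 = 0. *)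
Definition Dmax (T : finType) (mu nu : distr R T) : \bar R :=
  log2 (\big[maxe/-oo]_(x : T) ((mu x)%:E / (nu x)%:E)).

(* The maximum over an empty family (which occurs iff delta >= 1) is -oo, and
   so is its logarithm. *)
Definition Dmax_approx (delta : R) (T : finType) (mu nu : distr R T) : \bar R :=
  log2 (\big[maxe/-oo]_(O : {set T} | (delta < Pr mu O)%R)
          ((Pr mu O - delta)%:E / (Pr nu O)%:E)).

(* I_oo^beta (X; Y), as a function of the joint law [mu] of (X, Y). *)
Definition Imax_approx (beta : R) (T U : finType) (mu : distr R (T * U)%type) :
  \bar R := Dmax_approx beta mu (dprod (dmap fst mu) (dmap snd mu)).

Definition neighbors (X : finType) (n : nat) (s s' : (X ^ n)%type) : bool :=
  #|[set i | s i != s' i]| == 1%N.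

Definition diff_private (eps : R) (X Y : finType) (n : nat)
    (A : (X ^ n)%type -> distr R Y) : Prop :=
  forall s s' : (X ^ n)%type, neighbors s s' ->
    Dmax (A s) (A s') <= log2 (expR eps)%:E.

End Divergences.

(* Main.v *)
Require Import Defs.
From HB Require Import structures.
From mathcomp Require Import all_boot all_order all_algebra.
From mathcomp Require Import reals ereal sequences exp.
From mathcomp Require Import boolp classical_sets interval_inference normedtype.
From mathcomp Require Import derive realfun convex hoelder.
From mathcomp Require Import ring lra.

Set Implicit Arguments.
Unset Strict Implicit.
Unset Printing Implicit Defensive.

Import Order.TTheory GRing.Theory Num.Theory.
Import numFieldNormedType.Exports.

Local Open Scope ring_scope.

(* Fix an output [y], let [F s = Pr[A s = y]] and [N = E F] under [P^n]. By
   privacy, changing one coordinate of [s] changes [F] by a factor at most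
   [e^eps], so applying Hoeffding's lemma and Jensen's inequality to one
   coordinate at a time gives [E F^m <= e^(n (m eps)^2 / 8) N^m] for [m >= 1].
   On the event [F > e^k N], [F <= F^m (e^k N)^(1 - m)], so the joint law gives
   this event together with [Y = y] a mass of at most
   [e^(n (m eps)^2 / 8 - (m - 1) k) N]. For the optimal [m] this is at most
   [beta N], and summing over [y] shows that the joint law exceeds [e^k] times
   the product of its marginals only on an event of mass at most [beta]. *)

(** * Moments of a two-point law *)

Lemma derive_ge0_le (R : realType) (f df : R -> R) (u : R) : 0 <= u ->
  (forall x : R, 0 <= x -> is_derive x 1 f (df x)) ->
  (forall x : R, 0 <= x -> 0 <= df x) -> f 0 <= f u.
Proof.
move=> u0 fdf df0.
have [x xu|x|c] := @MVT_segment R f df 0 u u0.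
- by apply: fdf; move: xu; rewrite in_itv /= => /andP[/ltW].
- apply: derivable_within_continuous => y; rewrite in_itv /= => /andP[y0 _].
  by have [] := fdf _ y0.
rewrite in_itv /= => /andP[c0 _] fE; rewrite -subr_ge0 fE subr0.
by rewrite mulr_ge0 ?df0.
Qed.

(** Hoeffding's lemma for a Bernoulli variable: [phi], the difference of the logarithms of the two
    sides, vanishes at 0 together with [dphi], and [ddphi >= 0]. Monotonicity, first of [dphi] and
    then of [phi], gives [phi u >= 0]. *)
Lemma bernoulli_mgf_le (R : realType) (p u : R) : 0 <= p <= 1 -> 0 <= u ->
  1 - p + p * expR u <= expR (p * u + u ^+ 2 / 8).
Proof.
move=> /andP[p0 p1] u0; pose D x : R := 1 - p + p * expR x.
have D_gt0 x : 0 < D x.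
  rewrite /D; have [->|pN0] := eqVneq p 0; first by lra.
  have : 0 < p * expR x by rewrite mulr_gt0 ?expR_gt0 // lt_def pN0.
  by move: p1; lra.
have dD (x : R) : is_derive x 1 D (p * expR x).
  by rewrite /D; apply: is_derive_eq; rewrite /GRing.scale /=; ring.
(* [phi'' = (1/2 - q)^2] for [q = p e^x / D x], hence the constant [8]. *)
pose phi x : R := p * x + x ^+ 2 / 8 - ln (D x).
pose dphi x : R := p + x / 4 - p * expR x * (D x)^-1.
pose ddphi x : R := 1 / 4 - p * (1 - p) * expR x * (D x)^-1 ^+ 2.
have dphiP (x : R) : is_derive x 1 phi (dphi x).
  have dlnD : is_derive x 1 (fun x => ln (D x)) ((D x)^-1 * (p * expR x)).
    exact: (is_derive1_comp (is_derive1_ln (D_gt0 x)) (dD x)).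
  have dq : is_derive x 1 (fun x : R => p * x + x ^+ 2 / 8) (p + x / 4).
    by apply: is_derive_eq; rewrite /GRing.scale /= ?mulr0; lra.
  by apply: (is_derive_eq (is_deriveB dq dlnD)); rewrite /dphi; ring.
have ddphiP (x : R) : is_derive x 1 dphi (ddphi x).
  have dVD := is_deriveV (lt0r_neq0 (D_gt0 x)) (dD x).
  have dq : is_derive x 1 (fun x : R => p + x / 4) (1 / 4).
    by apply: is_derive_eq; rewrite /GRing.scale /= ?mulr0; lra.
  have de : is_derive x 1 (fun x : R => p * expR x) (p * expR x).
    by apply: is_derive_eq; rewrite /GRing.scale /=; ring.
  apply: (is_derive_eq (is_deriveB dq (is_deriveM de dVD))).
  rewrite /ddphi /GRing.scale /=.
  have DN0 := lt0r_neq0 (D_gt0 x); rewrite /D in DN0 *.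
  by field.
have ddphi_ge0 x : 0 <= ddphi x.
  have -> : ddphi x = (1 / 2 - p * expR x * (D x)^-1) ^+ 2.
    by rewrite /ddphi; have DN0 := lt0r_neq0 (D_gt0 x); rewrite /D in DN0 *; field.
  exact: sqr_ge0.
have D0 : D 0 = 1 by rewrite /D expR0; ring.
have dphi_ge0 x : 0 <= x -> 0 <= dphi x.
  move=> x0; have -> : 0 = dphi 0 by rewrite /dphi D0 expR0; field.
  exact: derive_ge0_le x0 (fun x _ => ddphiP x) (fun x _ => ddphi_ge0 x).
have := derive_ge0_le u0 (fun x _ => dphiP x) dphi_ge0.
rewrite /phi D0 ln1 -[1 - _ + _]/(D u) -(@ler_ln _ (D u)) ?posrE ?expR_gt0 ?D_gt0 //.
by rewrite expRK; lra.
Qed.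

(** Convexity of the [m]-th power between 1 and [v]. It serves to replace a variable with values in
    [[1, v]] by a two-point variable of the same mean. *)
Lemma powR_chord_le (R : realType) (m t v : R) : 1 <= m -> 0 <= t <= 1 ->
  0 <= v -> (1 - t + t * v) `^ m <= 1 - t + t * v `^ m.
Proof.
move=> m1 /andP[t0 t1] v0.
have ti : Itv.spec (@Itv.num_sem R) (Itv.Real `[0%Z, 1%Z]) t.
  by apply/and3P; split => //=; rewrite ?ger0_real// in_itv/= t0.
have chord : (t * v + (1 - t) * 1) `^ m <= t * v `^ m + (1 - t) * 1 `^ m.
  by apply: (convex_powR m1 (Itv.mk ti)); rewrite inE /= in_itv /= andbT.
by move: chord; rewrite powR1 !mulr1 addrC [X in _ <= X]addrC.
Qed.

(** Hoeffding's lemma at [m * e] leaves the [m]-th power of [expR (p * e)], which Jensen's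
    inequality [le_pe] bounds by that of the mean. *)
Lemma expR_two_point (R : realType) (p e m : R) : 0 <= p <= 1 -> 0 <= e ->
  0 <= m -> 1 - p + p * expR (m * e) <=
            expR ((m * e) ^+ 2 / 8) * (1 - p + p * expR e) `^ m.
Proof.
move=> /[dup] p01 /andP[p0 p1] e0 m0.
apply: le_trans (bernoulli_mgf_le p01 (mulr_ge0 m0 e0)) _.
rewrite addrC expRD ler_pM2l ?expR_gt0 //.
have -> : p * (m * e) = (p * e) * m by ring.
have le_pe : expR (p * e) <= 1 - p + p * expR e.
  (* The tangent bound [expR x >= 1 + x] is taken at the two deviations from [p * e]. Their weighted
     mean is 0, so the bracket left after factoring out [expR (p * e)] is at least 1. *)
  have ge1 := expR_ge1Dx ((1 - p) * e); have ge2 := expR_ge1Dx (- (p * e)).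
  have expe : expR e = expR (p * e) * expR ((1 - p) * e).
    by rewrite -expRD; congr expR; ring.
  have -> : 1 - p + p * expR e =
      expR (p * e) * ((1 - p) * expR (- (p * e)) + p * expR ((1 - p) * e)).
    by rewrite expe expRN; field; rewrite gt_eqF ?expR_gt0.
  rewrite ler_peMr ?expR_ge0 //; nra.
by rewrite expRM ge0_ler_powR // nnegrE ?expR_ge0 // (le_trans _ le_pe) ?expR_ge0.
Qed.

(** * Moment bound for one coordinate *)

Lemma mean_bounds (R : realType) (T : finType) (mu : distr R T) (f : T -> R)
    (a b : R) : (forall x, a <= f x <= b) -> a <= \sum_x mu x * f x <= b.
Proof.
move=> fab; rewrite -[a]mul1r -[b]mul1r -(pmf_sum1 mu) !mulr_suml.
by apply/andP; split; apply: ler_sum => x _; have /andP[? ?] := fab x;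
  rewrite ler_wpM2l ?pmf_ge0.
Qed.

(** Dividing by the minimum [a] places [f] in [[1, expR e]], where it interpolates between the
    endpoints with weight [t]. Convexity then reduces the claim to the two-point law whose parameter
    [p] is the mean of [t]. *)
Lemma mean_powR_le (R : realType) (T : finType) (mu : distr R T) (f : T -> R)
    (e m : R) : 0 <= e -> 1 <= m -> (forall x, 0 <= f x) ->
  (forall x x', f x <= expR e * f x') ->
  \sum_x mu x * f x `^ m <=
    expR ((m * e) ^+ 2 / 8) * (\sum_x mu x * f x) `^ m.
Proof.
move=> e0 m1 f0 fe.
have m0 : m != 0 by rewrite gt_eqF // (lt_le_trans ltr01).
have [x0|noT] := pickP (pred_of_argType T); last first.
  by rewrite big_pred0 // mulr_ge0 ?expR_ge0 ?powR_ge0.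
move=> _; pose x1 := [arg min_(x < x0) f x]%O; pose a := f x1.
have af x : a <= f x by rewrite /a /x1; case: arg_minP => // i _; apply.
have [a_eq0|aN0] := eqVneq a 0.
  have fE x : f x = 0.
    by apply/le_anti; rewrite f0 andbT (le_trans (fe x x1)) // -/a a_eq0 mulr0.
  by rewrite big1 ?mulr_ge0 ?expR_ge0 ?powR_ge0 // => x _; rewrite fE powR0 ?mulr0.
have a_gt0 : 0 < a by rewrite lt_def aN0 f0.
(* If [e = 0], the denominator is 0 and [t x] is 0 by convention; [f] is then constantly [a], so
   [fE] still holds. *)
pose t x := (f x / a - 1) / (expR e - 1).
have e1 : 1 <= expR e by rewrite -expR0 ler_expR.
have fa x : 1 <= f x / a <= expR e.
  by rewrite ler_pdivlMr // mul1r af ler_pdivrMr // fe.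
have t01 x : 0 <= t x <= 1.
  have /andP[fa1 fa2] := fa x; rewrite /t divr_ge0 ?subr_ge0 //=.
  have [->|eN1] := eqVneq (expR e) 1; first by rewrite subrr invr0 mulr0.
  by rewrite ler_pdivrMr ?mul1r ?lerB // subr_gt0 lt_def eN1.
have fE x : f x = a * (1 - t x + t x * expR e).
  suff -> : 1 - t x + t x * expR e = f x / a by rewrite mulrCA divff ?mulr1.
  have /andP[fa1 fa2] := fa x; rewrite /t; have [ee|eN1] := eqVneq (expR e) 1.
    by rewrite ee subrr invr0 mulr0 mul0r subr0 addr0; apply/le_anti; rewrite fa1 -ee.
  by field; rewrite aN0 subr_eq0.
pose p := \sum_x mu x * t x.
have p01 : 0 <= p <= 1 := mean_bounds mu t01.
have meanE (u v : R) : \sum_x mu x * (u * (1 - t x + t x * v)) = u * (1 - p + p * v).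
  transitivity (u * (\sum_x mu x + (v - 1) * p)); last by rewrite pmf_sum1; ring.
  rewrite /p mulrDr !mulr_sumr -big_split /=.
  by apply: eq_bigr => x _; ring.
have -> : \sum_x mu x * f x = a * (1 - p + p * expR e).
  by rewrite -meanE; apply: eq_bigr => x _; rewrite -fE.
have b0 (q : R) : 0 <= q <= 1 -> 0 <= 1 - q + q * expR e.
  by move=> /andP[q0 q1]; rewrite addr_ge0 ?subr_ge0 ?mulr_ge0 ?expR_ge0.
apply: (@le_trans _ _ (a `^ m * (1 - p + p * expR (m * e)))).
  rewrite -meanE; apply: ler_sum => x _; rewrite ler_wpM2l ?pmf_ge0 //.
  rewrite fE powRM ?b0 ?(ltW a_gt0) ?t01 // ler_wpM2l ?powR_ge0 // [m * e]mulrC expRM.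
  exact: powR_chord_le m1 (t01 x) (expR_ge0 e).
rewrite powRM ?b0 ?(ltW a_gt0) // mulrCA ler_wpM2l ?powR_ge0 //.
by apply: expR_two_point; rewrite // (le_trans ler01).
Qed.

(** * Moment bound for i.i.d. coordinates *)

Section FfunCons.
Variables (X : Type) (n : nat).

Definition ffun_cons (p : X * (X ^ n)%type) : (X ^ n.+1)%type :=
  [ffun i => if unlift ord0 i is Some j then p.2 j else p.1].

Lemma ffun_cons0 p : ffun_cons p ord0 = p.1.
Proof. by rewrite ffunE unlift_none. Qed.

Lemma ffun_consS p j : ffun_cons p (lift ord0 j) = p.2 j.
Proof. by rewrite ffunE liftK. Qed.

Lemma ffun_cons_bij : bijective ffun_cons.
Proof.
exists (fun s : (X ^ n.+1)%type => (s ord0, [ffun j => s (lift ord0 j)]))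
  => [[x s]|s] /=.
  by rewrite ffun_cons0; congr pair; apply/ffunP => j; rewrite ffunE ffun_consS.
apply/ffunP => i; rewrite ffunE.
by case: unliftP => [j ->|->] //=; rewrite ffunE.
Qed.
End FfunCons.

Lemma diid_sum_cons (R : realType) (X : finType) (P : distr R X) (n : nat)
    (F : (X ^ n.+1)%type -> R) :
  \sum_s diid P n.+1 s * F s =
  \sum_s diid P n s * \sum_x P x * F (ffun_cons (x, s)).
Proof.
rewrite (reindex (@ffun_cons X n)) /=; last exact/onW_bij/ffun_cons_bij.
under [RHS]eq_bigr do rewrite mulr_sumr.
rewrite [RHS]exchange_big pair_bigA /=; apply: eq_bigr => -[x s] _ /=.
rewrite /diid_pmf big_ord_recl ffun_cons0 /=.
under eq_bigr do rewrite ffun_consS.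
by rewrite mulrCA !mulrA.
Qed.

(** Induction on [n], averaging out coordinate 0: the average [G] keeps the ratio property in the
    other coordinates, so the induction hypothesis covers it. With those coordinates fixed,
    [mean_powR_le] costs one more factor [expR ((m * e) ^+ 2 / 8)]. *)
Lemma diid_mean_powR_le (R : realType) (X : finType) (P : distr R X) (n : nat)
    (F : (X ^ n)%type -> R) (e m : R) : 0 <= e -> 1 <= m ->
  (forall s, 0 <= F s) ->
  (forall (s s' : (X ^ n)%type) i,
    (forall j, j != i -> s j = s' j) -> F s <= expR e * F s') ->
  \sum_s diid P n s * F s `^ m <=
    expR (n%:R * ((m * e) ^+ 2 / 8)) * (\sum_s diid P n s * F s) `^ m.
Proof.
move=> e0 m1; elim: n F => [|n IHn] F F0 Fe.
  rewrite mul0r expR0 mul1r.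
  pose s0 : (X ^ 0)%type := ffun0 (card_ord 0).
  have sum0 (G : (X ^ 0)%type -> R) : \sum_s diid P 0 s * G s = G s0.
    rewrite (bigD1 s0) //= big1 ?addr0; first by rewrite /diid_pmf big_ord0 mul1r.
    by move=> s /eqP[]; apply/ffunP => -[].
  by rewrite !sum0.
pose G (s : (X ^ n)%type) := \sum_x P x * F (ffun_cons (x, s)).
have G0 (s : (X ^ n)%type) : 0 <= G s.
  by apply: sumr_ge0 => x _; rewrite mulr_ge0 ?pmf_ge0.
have Ge (s s' : (X ^ n)%type) i :
    (forall j, j != i -> s j = s' j) -> G s <= expR e * G s'.
  move=> ss'; rewrite mulr_sumr; apply: ler_sum => x _.
  rewrite mulrCA ler_wpM2l ?pmf_ge0 //; apply: (Fe _ _ (lift ord0 i)) => j.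
  case: (unliftP ord0 j) => [k ->|-> _]; last by rewrite !ffun_cons0.
  by rewrite (inj_eq (@lift_inj _ _)) !ffun_consS => /ss'.
rewrite !diid_sum_cons -/G -natr1 mulrDl mul1r expRD -mulrA mulrCA.
apply: le_trans (ler_wpM2l (expR_ge0 _) (IHn G G0 Ge)).
rewrite mulr_sumr; apply: ler_sum => s _.
rewrite mulrCA ler_wpM2l ?pmf_ge0 //; apply: mean_powR_le => // x x'.
apply: (Fe _ _ ord0) => j; case: (unliftP ord0 j) => [k ->|-> /eqP//] _.
by rewrite !ffun_consS.
Qed.

(** * Logarithms and pointwise privacy *)

Lemma log2_fin (R : realType) (r : R) : 0 < r -> log2 r%:E = (ln r / ln 2)%:E.
Proof.
move=> r0; have ln2 : ln 2 != 0 :> R by rewrite gt_eqF // ln_gt0 // ltr1n.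
by rewrite /log2 lne_EFin // inver (negbTE ln2).
Qed.

(** Strips the logarithm from the privacy hypothesis and from the goal. Nonpositive [x] cause no
    trouble: [log2] sends them to [-oo], and they lie below [expR k]. *)
Lemma le_log2_expR (R : realType) (x : \bar R) (k : R) :
  (log2 x <= log2 (expR k)%:E)%E = (x <= (expR k)%:E)%E.
Proof.
have ln2 : 0 < ln 2 :> R by rewrite ln_gt0 // ltr1n.
rewrite [X in (_ <= X)%E]log2_fin ?expR_gt0 // expRK.
have ln2V : (ln 2 : R)%:E^-1%E = ((ln 2)^-1)%:E by rewrite inver gt_eqF.
case: x => [r||]; last 2 first.
- by rewrite /log2 /= ln2V gt0_mulye ?lte_fin ?invr_gt0.
- by rewrite /log2 /= ln2V gt0_mulNye ?lte_fin ?invr_gt0 // !leNye.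
have [r0|r0] := leP r 0.
  rewrite /log2 /lne r0 ln2V gt0_mulNye ?lte_fin ?invr_gt0 // leNye lee_fin.
  by rewrite (le_trans r0) ?expR_ge0.
rewrite log2_fin // !lee_fin ler_pM2r ?invr_gt0 //.
by rewrite -[LHS]ler_expR lnK.
Qed.

Lemma diff_private_le (R : realType) (X Y : finType) (n : nat) (eps : R)
    (A : (X ^ n)%type -> distr R Y) : 0 <= eps -> diff_private eps A ->
  forall (s s' : (X ^ n)%type) i y, (forall j, j != i -> s j = s' j) ->
  A s y <= expR eps * A s' y.
Proof.
(* The two inputs may coincide, which [neighbors] excludes; [0 <= eps] settles that case. *)
move=> eps0 Adp s s' i y ss'; have [sE|sN] := eqVneq (s i) (s' i).
  have -> : s = s' by apply/ffunP => j; have [->//|/ss'] := eqVneq j i.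
  by rewrite ler_peMl ?pmf_ge0 // -expR0 ler_expR.
have nb : neighbors s s'.
  apply/cards1P; exists i; apply/setP => j; rewrite !inE.
  by have [->//|/ss' ->] := eqVneq j i; rewrite eqxx.
have := Adp _ _ nb; rewrite /Dmax le_log2_expR => Dle.
have : ((A s y)%:E / (A s' y)%:E <= (expR eps)%:E)%E.
  exact: le_trans (le_bigmax_cond -oo%E (fun x => (A s x)%:E / (A s' x)%:E)%E _) Dle.
(* A quotient [p / 0] with [p > 0] would be [+oo], so [A s y] vanishes wherever [A s' y] does. *)
rewrite inver; case: eqVneq => [s'0|s'N]; last first.
  by rewrite -EFinM lee_fin ler_pdivrMr // lt_def s'N pmf_ge0.
have [->|sN0] := eqVneq (A s y) 0; first by rewrite s'0 mulr0.
by rewrite gt0_muley // lte_fin lt_def sN0 pmf_ge0.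
Qed.

(** * Reduction to a tail bound for each output *)

Lemma dmap_fst_djoint (R : realType) (T U : finType) (mu : distr R T)
    (K : T -> distr R U) (x : T) : dmap fst (djoint mu K) x = mu x.
Proof.
rewrite /= /dmap_pmf /Pr -[RHS]mulr1 -(pmf_sum1 (K x)) mulr_sumr.
rewrite (reindex (pair x)) /=; last first.
  by exists snd => [//|[x' u]]; rewrite !inE /= => /eqP ->.
by apply: eq_bigl => u; rewrite inE eqxx.
Qed.

Lemma dmap_snd_djoint (R : realType) (T U : finType) (mu : distr R T)
    (K : T -> distr R U) (u : U) :
  dmap snd (djoint mu K) u = \sum_x mu x * K x u.
Proof.
rewrite /= /dmap_pmf /Pr (reindex (fun x : T => (x, u))) /=; last first.
  by exists fst => [//|[x u']]; rewrite !inE /= => /eqP ->.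
by apply: eq_bigl => x; rewrite inE eqxx.
Qed.

(** Where [A x y <= K * N y], the joint law is pointwise at most [K * nu]. The remaining points
    carry the mass [bad], whose total is at most the sum of [beta * N y], that is, [beta]. *)
Lemma Pr_djoint_sub_le (R : realType) (T U : finType) (mu : distr R T)
    (A : T -> distr R U) (K beta : R) (O : {set T * U}) :
  let nu := dprod (dmap fst (djoint mu A)) (dmap snd (djoint mu A)) in
  let N y := \sum_x mu x * A x y in 0 <= K ->
  (forall y, \sum_(x | K * N y < A x y) mu x * A x y <= beta * N y) ->
  Pr (djoint mu A) O - beta <= K * Pr nu O.
Proof.
move=> nu N K0 tail; rewrite lerBlDr.
have NE (y : U) : dmap snd (djoint mu A) y = N y := dmap_snd_djoint mu A y.
have sumN : \sum_y N y = 1.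
  by rewrite -(pmf_sum1 (dmap snd (djoint mu A))); apply: eq_bigr => y _; rewrite NE.
pose bad (p : T * U) := if K * N p.2 < A p.1 p.2 then mu p.1 * A p.1 p.2 else 0.
have bad0 p : 0 <= bad p by rewrite /bad; case: ifP => // _; rewrite mulr_ge0 ?pmf_ge0.
have ptw p : djoint mu A p <= K * nu p + bad p.
  have nuE : nu p = mu p.1 * N p.2 by rewrite /= /djoint_pmf dmap_fst_djoint NE.
  rewrite nuE /bad /= /djoint_pmf; case: ltP => [_|le].
    rewrite lerDr !mulr_ge0 ?pmf_ge0 //.
    by apply: sumr_ge0 => x _; rewrite mulr_ge0 ?pmf_ge0.
  by rewrite addr0 mulrCA ler_wpM2l ?pmf_ge0.
apply: le_trans (ler_sum _ (fun p _ => ptw p)) _.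
rewrite big_split /= -mulr_sumr lerD2l.
apply: (@le_trans _ _ (\sum_p bad p)).
  by rewrite [X in _ <= X](bigID (mem O)) /= lerDl sumr_ge0.
rewrite -(pair_bigA _ (fun x y => bad (x, y))) exchange_big /=.
rewrite -[beta]mulr1 -sumN mulr_sumr; apply: ler_sum => y _.
by rewrite -big_mkcond /=; exact: tail.
Qed.

(** * Tail bounds from moments *)

(** A Markov inequality: since [1 - m <= 0], the [(1 - m)]-th power of [f x] is at most that of
    [K * N] on the event. *)
Lemma tail_moment_le (R : realType) (T : finType) (mu : distr R T) (f : T -> R)
    (C K m : R) : let N := \sum_x mu x * f x in
  0 < K -> 1 <= m -> (forall x, 0 <= f x) ->
  \sum_x mu x * f x `^ m <= C * N `^ m ->
  \sum_(x | K * N < f x) mu x * f x <= C * K `^ (1 - m) * N.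
Proof.
move=> N K0 m1 f0 mom.
have N0 : 0 <= N by apply: sumr_ge0 => x _; rewrite mulr_ge0 ?pmf_ge0.
have mf0 x : 0 <= mu x * f x by rewrite mulr_ge0 ?pmf_ge0.
have [NE|NN0] := eqVneq N 0.
  have /psumr_eq0P NP : N = 0 by [].
  by rewrite big1 => [|x _]; rewrite ?NE ?mulr0 // NP.
have N_gt0 : 0 < N by rewrite lt_def NN0.
have KN0 : 0 < K * N by rewrite mulr_gt0.
have -> : C * K `^ (1 - m) * N = (K * N) `^ (1 - m) * (C * N `^ m).
  rewrite powRM ?ltW // mulrACA -powRD ?NN0 ?implybT // subrK powRr1 //.
  by rewrite [K `^ _ * C]mulrC.
apply: le_trans (ler_wpM2l (powR_ge0 _ _) mom); rewrite [X in _ <= X]mulr_sumr.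
rewrite [X in _ <= X](bigID (fun x => K * N < f x)) /= -[X in X <= _]addr0.
apply: lerD; last by apply: sumr_ge0 => x _; rewrite !mulr_ge0 ?powR_ge0 ?pmf_ge0.
apply: ler_sum => x Kf; rewrite mulrCA ler_wpM2l ?pmf_ge0 //.
have fx0 : 0 < f x := lt_trans KN0 Kf.
rewrite -{1}[f x]powRr1 ?f0 // -{1}(subrK m 1) powRD ?(gt_eqF fx0) ?implybT //.
rewrite ler_wpM2r ?powR_ge0 // -opprB !powRN lef_pV2 ?posrE ?powR_gt0 //.
by rewrite ge0_ler_powR ?nnegrE ?subr_ge0 // ltW.
Qed.

(** The hypothesis makes the variance of [f] zero, so [mu] puts no mass where [f] differs from
    [N]. *)
Lemma tail_second_moment_eq0 (R : realType) (T : finType) (mu : distr R T)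
    (f : T -> R) : let N := \sum_x mu x * f x in
  \sum_x mu x * f x ^+ 2 <= N ^+ 2 ->
  \sum_(x | N < f x) mu x * f x = 0.
Proof.
move=> N mom; have var0 : \sum_x mu x * (f x - N) ^+ 2 = 0.
  apply/le_anti/andP; split; last first.
    by apply: sumr_ge0 => x _; rewrite mulr_ge0 ?pmf_ge0 ?sqr_ge0.
  have -> : \sum_x mu x * (f x - N) ^+ 2 =
     \sum_x mu x * f x ^+ 2 - 2 * N * N + N ^+ 2 * \sum_x mu x.
    rewrite [N ^+ 2 * _]mulr_sumr -mulNr.
    rewrite [- (2 * N) * _]mulr_sumr -!big_split /=.
    by apply: eq_bigr => x _; ring.
  by rewrite pmf_sum1; lra.
have /psumr_eq0P mu0 := var0.
rewrite big1 // => x Nf.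
have /eqP := mu0 (fun x _ => mulr_ge0 (pmf_ge0 _ x) (sqr_ge0 _)) x erefl.
by rewrite mulf_eq0 sqrf_eq0 subr_eq0 (gt_eqF Nf) orbF => /eqP ->; rewrite mul0r.
Qed.

Lemma diid_tail_le (R : realType) (X : finType) (P : distr R X) (n : nat)
    (F : (X ^ n)%type -> R) (eps beta : R) :
  let N := \sum_s diid P n s * F s in
  let k := eps ^+ 2 * n%:R / 2 + eps * Num.sqrt (n%:R * ln (2 / beta) / 2) in
  0 <= eps -> 0 < beta <= 2 -> (forall s, 0 <= F s) ->
  (forall (s s' : (X ^ n)%type) i,
    (forall j, j != i -> s j = s' j) -> F s <= expR eps * F s') ->
  \sum_(s | expR k * N < F s) diid P n s * F s <= beta * N.
Proof.
move=> N k e0 /andP[b0 b2] F0 Fe; set L := ln (2 / beta) in k *.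
have N0 : 0 <= N by apply: sumr_ge0 => x _; rewrite mulr_ge0 ?pmf_ge0.
(* Here [beta <= 2] keeps the radicand nonnegative, so that [r ^+ 2] can be computed. *)
have L0 : 0 <= L by rewrite ln_ge0 // ler_pdivlMr // mul1r.
set r := eps * _ in k *.
have r0 : 0 <= r by rewrite mulr_ge0 ?sqrtr_ge0.
pose c := eps ^+ 2 * n%:R.
have r2 : r ^+ 2 = c * L / 2.
  by rewrite exprMn sqr_sqrtr /c ?divr_ge0 ?mulr_ge0 //; ring.
have c0 : 0 <= c by rewrite mulr_ge0 ?sqr_ge0.
(* The optimal [m] degenerates when [c = 0]; there [m = 2] forces [F = N]
   almost surely. *)
have [cE|cN0] := eqVneq c 0.
  have k0 : k = 0.
    rewrite /k -/c cE mul0r add0r; apply/eqP.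
    by rewrite -(sqrf_eq0 r) r2 cE !mul0r.
  rewrite k0 expR0 mul1r (tail_second_moment_eq0 _) ?mulr_ge0 ?(ltW b0) //.
  have := diid_mean_powR_le P e0 (ler1n R 2) F0 Fe.
  have -> : n%:R * ((2%:R * eps) ^+ 2 / 8) = 0 :> R.
    by rewrite -[RHS](mulr0 (1/2)) -cE /c; field.
  rewrite expR0 mul1r powR_mulrn //; congr (_ <= _).
  by apply: eq_bigr => s _; rewrite powR_mulrn.
have c_gt0 : 0 < c by rewrite lt_def cN0.
have kE : k = c / 2 + r by [].
(* [m] minimises the exponent [c m^2 / 8 + k (1 - m)]. *)
pose m := 4 * k / c.
have m1 : 1 <= m by rewrite ler_pdivlMr // kE; lra.
have mom := diid_mean_powR_le P e0 m1 F0 Fe.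
apply: le_trans (tail_moment_le (expR_gt0 k) m1 F0 mom) _.
rewrite ler_wpM2r // -expRM -expRD.
(* It suffices that the exponent be at most [- L], which yields [beta / 2]; the factor 2 is
   slack. *)
have -> : beta = 2 * expR (- L).
  by rewrite expRN lnK ?posrE ?divr_gt0 //; field; rewrite gt_eqF.
apply: (@le_trans _ _ (expR (- L))); last by rewrite ler_peMl ?expR_ge0 ?ler1n.
rewrite ler_expR.
have -> : n%:R * ((m * eps) ^+ 2 / 8) = c * m ^+ 2 / 8 by rewrite /c; field.
have -> : c * m ^+ 2 / 8 + k * (1 - m) = k - 2 * k ^+ 2 / c.
  by rewrite /m; field.
(* On expanding [k = c / 2 + r], the terms in [c] cancel and [2 * r ^+ 2 / c] is [L]. *)
have -> : k - 2 * k ^+ 2 / c = - r - L.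
  have -> : L = 2 * r ^+ 2 / c by rewrite r2; field.
  by rewrite kE; field.
lra.
Qed.

(** * Bound on the approximate max-information *)

Theorem theorem20 (R : realType) (X Y : finType) (n : nat) (eps : R)
    (eps_ge0 : 0 <= eps) (A : (X ^ n)%type -> distr R Y)
    (A_dp : diff_private eps A) (P : distr R X) (beta : R) (beta_gt0 : 0 < beta) :
  (Imax_approx beta (djoint (diid P n) A) <=
   log2 (expR 1)%:E *
   (eps ^+ 2 * n%:R / 2 + eps * Num.sqrt (n%:R * ln (2 / beta) / 2))%:E)%E.
Proof.
set k := eps ^+ 2 * n%:R / 2 + _.
have -> : (log2 (expR 1)%:E * k%:E = log2 (expR k)%:E)%E.
  by rewrite !log2_fin ?expR_gt0 // !expRK -EFinM mul1r mulrC.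
rewrite le_log2_expR; apply/bigmax_leP; split; first exact: leNye.
set mu := djoint _ A; set nu := dprod _ _ => O betaO.
(* A set in the family has mass above [beta], so [beta < 1], which supplies the bound [beta <= 2] of
   [diid_tail_le]. *)
have Pr_le1 : Pr mu O <= 1.
  rewrite -(pmf_sum1 mu) [X in _ <= X](bigID (mem O)) /= lerDl.
  by apply: sumr_ge0 => p _; exact: (pmf_ge0 mu).
have beta2 : 0 < beta <= 2 by rewrite beta_gt0; lra.
have O_le : Pr mu O - beta <= expR k * Pr nu O.
  apply: Pr_djoint_sub_le => [|y]; first exact: expR_ge0.
  apply: diid_tail_le => // [s|s s' i]; first exact: pmf_ge0.
  exact: diff_private_le.
have nu_ge0 : 0 <= Pr nu O by apply: sumr_ge0 => p _; apply: pmf_ge0.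
(* If [Pr nu O] were 0, [O_le] would give [Pr mu O <= beta], against the choice of [O]; the quotient
   is therefore finite. *)
rewrite inver; case: eqVneq => [nu0|nuN0].
  by move: O_le; rewrite nu0 mulr0 subr_le0 => /(lt_le_trans betaO); rewrite ltxx.
by rewrite -EFinM lee_fin ler_pdivrMr // lt_def nuN0.
Qed.
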